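(* In the real (resp. complex) projective 3-space, let $\ell_1,\ell_2$ be a generic pair of lines and let $m_1,m_2,m_3,m_4,m_5$ be five lines (generic subject to this condition) each of which pierces both $\ell_1$ and $\ell_2$. Pick a generic point $P_1$ on the line $m_3$. Find $P_2\in m_4$ such that $(P_1P_2)$ pierces $m_1$. Find $P_3\in m_5$ such that $(P_2P_3)$ pierces $m_2$. Find $P_4\in m_3$ such that $(P_3P_4)$ pierces $m_1$. Find $P_5\in m_4$ such that $(P_4P_5)$ pierces $m_2$. Find $P_6\in m_5$ such that $(P_5P_6)$ pierces $m_1$. Then $(P_6P_1)$ pierces $m_2$.
   Context: A line pierces another line if the two lines intersect. $(XY)$ denotes the line through two distinct points $X,Y$. ''Generic'' choices are choices belonging to a suitable Zariski dense subset of the appropriate configuration space; concretely, the assertion is that the conclusion holds for all choices in some nonempty Zariski open subset of the space of choices. *)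

(* Defs.v *)
From HB Require Import structures.
From mathcomp Require Import all_boot all_order all_algebra.
From mathcomp Require Import complex reals.
From mathcomp Require Import mpoly.

Set Implicit Arguments.
Unset Strict Implicit.
Unset Printing Implicit Defensive.

Import GRing.Theory.
Local Open Scope ring_scope.

Section ProjectiveSpace.
Variable F : fieldType.

(* Points and lines of the projective 3-space P(F^4) are the linear subspaces
   of F^4 of dimension 1 and 2. *)
Record point := Point {
  point_space :> {vspace 'rV[F]_4};
  point_dim : \dim point_space == 1%N }.

Record line := Line {
  line_space :> {vspace 'rV[F]_4};
  line_dim : \dim line_space == 2%N }.

HB.instance Definition _ := [isSub for point_space].
HB.instance Definition _ := [Equality of point by <:].
HB.instance Definition _ := [isSub for line_space].
HB.instance Definition _ := [Equality of line by <:].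

Definition on_line (P : point) (l : line) : bool := (P <= l)%VS.

Definition pierces (l l' : line) : bool := ((l :&: l')%VS != 0%VS).

Lemma dim_join (P Q : point) : P != Q -> \dim (P + Q)%VS == 2%N.
Proof.
case: P Q => [U dU] [V dV]; rewrite -val_eqE /= => nUV.
have cap0 : \dim (U :&: V)%VS = 0%N.
  apply/eqP; rewrite -leqn0 leqNgt; apply/negP => cap_gt0.
  have eqU : (U :&: V)%VS = U.
    by apply/eqP; rewrite eqEdim capvSl (eqP dU).
  have eqV : (U :&: V)%VS = V.
    by apply/eqP; rewrite eqEdim capvSr (eqP dV).
  by move/eqP: nUV; apply; rewrite -eqU eqV.
have := dimv_sum_cap U V.
by rewrite cap0 addn0 (eqP dU) (eqP dV) => ->.
Qed.

Definition line_through (P Q : point) (neqPQ : P != Q) : line :=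
  Line (dim_join neqPQ).

(* The line (PQ) exists, i.e. P and Q are distinct, and it pierces l. *)
Definition join_pierces (P Q : point) (l : line) : Prop :=
  exists neqPQ : P != Q, pierces (line_through neqPQ) l.

(* The space of choices.  A generic pair of lines is skew; this open condition
   is built in because, without it, the tuples with l1 = l2 would form an
   additional irreducible component, of larger dimension. *)
Record config := Config {
  l1 : line; l2 : line;
  m1 : line; m2 : line; m3 : line; m4 : line; m5 : line;
  P1 : point;
  skew_l1_l2 : ~~ pierces l1 l2;
  m1_pierces : pierces m1 l1 && pierces m1 l2;
  m2_pierces : pierces m2 l1 && pierces m2 l2;
  m3_pierces : pierces m3 l1 && pierces m3 l2;
  m4_pierces : pierces m4 l1 && pierces m4 l2;
  m5_pierces : pierces m5 l1 && pierces m5 l2;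
  P1_on_m3 : on_line P1 m3 }.

Definition config_lines (c : config) : 7.-tuple line :=
  [tuple l1 c; l2 c; m1 c; m2 c; m3 c; m4 c; m5 c].

Definition point_coords (P : point) (p : 'rV[F]_4) : Prop :=
  point_space P = <[p]>%VS.

(* The (i, j) entry is the Pluecker coordinate u_i v_j - u_j v_i; keeping all
   16 entries is harmless, the extra ones being zero or opposite to others. *)
Definition pluecker_coords (l : line) (A : 'M[F]_4) : Prop :=
  exists u v : 'rV[F]_4,
    line_space l = (<[u]> + <[v]>)%VS /\ A = u^T *m v - v^T *m u.

Definition config_coords (c : config) (z : 'rV[F]_(7 * (4 * 4) + 4)) : Prop :=
  (forall i : 'I_7,
     pluecker_coords (tnth (config_lines c) i)
                     (vec_mx (row i (vec_mx (lsubmx z)))))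
  /\ point_coords (P1 c) (rsubmx z).

(* Zariski closed subsets of the space of choices, seen inside a product of
   projective spaces through Pluecker coordinates.  The polynomials are
   required to vanish at all the homogeneous coordinates of a configuration;
   over an infinite field this amounts to the vanishing of all their
   multihomogeneous components. *)
Definition zero_locus (S : {mpoly F[7 * (4 * 4) + 4]} -> Prop) (c : config)
    : Prop :=
  forall f, S f -> forall z, config_coords c z -> f.@[fun k => z 0 k] = 0.

Definition zariski_open (U : config -> Prop) : Prop :=
  exists S, forall c, U c <-> ~ zero_locus S c.

Definition zariski_dense (U : config -> Prop) : Prop :=
  forall V, zariski_open V -> (exists c, V c) -> exists c, U c /\ V c.

Definition generically (Q : config -> Prop) : Prop :=
  exists U, [/\ zariski_open U, exists c, U c, zariski_dense U
              & forall c, U c -> Q c].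

(* "Find P such that S P; then K P": the step can be carried out, and K holds
   however it is carried out. *)
Definition find_point (S K : point -> Prop) : Prop :=
  (exists P, S P) /\ (forall P, S P -> K P).

Definition closes_up (c : config) : Prop :=
  find_point (fun P2 => on_line P2 (m4 c) /\ join_pierces (P1 c) P2 (m1 c)) (fun P2 =>
  find_point (fun P3 => on_line P3 (m5 c) /\ join_pierces P2 P3 (m2 c)) (fun P3 =>
  find_point (fun P4 => on_line P4 (m3 c) /\ join_pierces P3 P4 (m1 c)) (fun P4 =>
  find_point (fun P5 => on_line P5 (m4 c) /\ join_pierces P4 P5 (m2 c)) (fun P5 =>
  find_point (fun P6 => on_line P6 (m5 c) /\ join_pierces P5 P6 (m1 c)) (fun P6 =>
  join_pierces P6 (P1 c) (m2 c)))))).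

End ProjectiveSpace.

(* Main.v *)
Require Import Defs.
From mathcomp Require Import all_boot all_order all_algebra.
From mathcomp Require Import complex reals.
From mathcomp Require Import mpoly ring boolp.

(** Why the hexagon closes.  Since l1 and l2 are skew, F^4 = l1 + l2 (direct),
and a line m_k meeting both is spanned by a vector a_k of l1 and a vector b_k
of l2.  A point of m_k is then s a_k + t b_k, with homogeneous coordinates
(s : t).  Write A_ik and B_ik for the 2 x 2 determinants of (a_i, a_k) and
(b_i, b_k) in bases of l1 and l2.  In the determinant of the four vectors
P = s a_i + t b_i, Q = x a_j + y b_j, a_k, b_k only the terms with two vectors
in l1 and two in l2 survive, so that (PQ) pierces m_k exactly when
t x A_jk B_ik = s y A_ik B_jk (join_ptE).  Hence passing from m_i to m_j by
piercing m_k is the diagonal projective map with multiplier f_ik / f_jk, where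
f_ik = A_ik / B_ik.  Along the hexagon the multipliers are
  f_31/f_41, f_42/f_52, f_51/f_31, f_32/f_42, f_41/f_51, f_52/f_32,
and their product is 1 (generic_closes_up).

What has to be avoided is only that one of these brackets vanishes or that two
consecutive points coincide; both are excluded when m_1, ..., m_5 are pairwise
skew.  Skewness of two lines is the nonvanishing of a bilinear form in their
Pluecker coordinates, so the good configurations are the nonvanishing locus of
one polynomial, skew_poly.

Density of this locus is the irreducibility of the space of choices, obtained
from an explicit parametrization by vectors spanning l1 and l2 and coordinates
of the a_k, b_k and P1 (config_coords_param: every configuration, with any
choice of homogeneous coordinates, is reached).  Given a configuration in an
open set V, its parameters are joined by an affine segment to those of a
fixed configuration whose lines m_k are pairwise skew.  The equation of V and
skew_poly restrict to two nonzero univariate polynomials on this segment, and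
over an infinite field they have a common nonroot. *)

Set Implicit Arguments.
Unset Strict Implicit.
Unset Printing Implicit Defensive.

Import GRing.Theory Num.Theory.
Local Open Scope ring_scope.

Local Notation o2 k := (@Ordinal 2 k isT).
Local Notation o4 k := (@Ordinal 4 k isT).
Local Notation o5 k := (@Ordinal 5 k isT).
Local Notation o7 k := (@Ordinal 7 k isT).

(** * Lines and pairs of spanning vectors *)

Section Spans.
Variable F : fieldType.
Implicit Types u v x y w : 'rV[F]_4.

Definition quad u v x y : 'M[F]_4 :=
  \matrix_(i < 4) nth 0 [:: u; v; x; y] i.

Definition row4 (a b c d : F) : 'rV[F]_4 := \row_j nth 0 [:: a; b; c; d] j.

Lemma mul_quad (r : 'rV[F]_4) u v x y : r *m quad u v x y =
  r 0 (o4 0) *: u + r 0 (o4 1) *: v + (r 0 (o4 2) *: x + r 0 (o4 3) *: y).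
Proof.
rewrite mulmx_sum_row !big_ord_recl big_ord0 !rowK /= addr0 !addrA.
by congr (r 0 _ *: _ + r 0 _ *: _ + r 0 _ *: _ + r 0 _ *: _); apply/val_inj.
Qed.

Definition wedge u v : 'M[F]_4 := u^T *m v - v^T *m u.

Lemma wedgeE u v i j : wedge u v i j = u 0 i * v 0 j - v 0 i * u 0 j.
Proof. by rewrite !mxE !big_ord1 !mxE. Qed.

(** The polar form of the Klein quadric: the six terms of the Laplace expansion
of a 4 x 4 determinant along its first two rows.  The ring and the indexing of
the entries are free so that it can be evaluated both at Pluecker coordinates
and at polynomial variables. *)
Definition klein (R : pzRingType) (A B : 'I_4 -> 'I_4 -> R) :=
  A (o4 0) (o4 1) * B (o4 2) (o4 3) - A (o4 0) (o4 2) * B (o4 1) (o4 3)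
  + A (o4 0) (o4 3) * B (o4 1) (o4 2) + A (o4 1) (o4 2) * B (o4 0) (o4 3)
  - A (o4 1) (o4 3) * B (o4 0) (o4 2) + A (o4 2) (o4 3) * B (o4 0) (o4 1).

Lemma det_quad u v x y :
  \det (quad u v x y) = klein (wedge u v) (wedge x y).
Proof.
(* Naming each entry by the natural number of its column identifies the
   various ordinals that the expansions produce for one column. *)
pose c (z : 'rV[F]_4) k := z 0 (inord k).
have Ez (z : 'rV[F]_4) i : z 0 i = c z i by rewrite /c inord_val.
rewrite /klein !wedgeE !Ez /=.
rewrite (expand_det_row _ ord0) !big_ord_recl !big_ord0 /cofactor.
rewrite !(expand_det_row _ ord0) !big_ord_recl !big_ord0 /cofactor.
rewrite !(expand_det_row _ ord0) !big_ord_recl !big_ord0 /cofactor.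
rewrite !det_mx11 !mxE /= !Ez /= /bump /=.
ring.
Qed.

Lemma mem_span2 w u v :
  reflect (exists a b : F, w = a *: u + b *: v) (w \in (<[u]> + <[v]>)%VS).
Proof.
apply: (iffP memv_addP) => [[_ /vlineP[x ->] [_ /vlineP[y ->] ->]]|[x [y ->]]].
  by exists x, y.
exists (x *: u); first by apply/vlineP; exists x.
by exists (y *: v) => //; apply/vlineP; exists y.
Qed.

Lemma dim_span2 u v :
  reflect (forall x y : F, x *: u + y *: v = 0 -> x = 0 /\ y = 0)
          (\dim (<[u]> + <[v]>) == 2)%VS.
Proof.
have -> : (\dim (<[u]> + <[v]>) == 2)%VS = free [:: u; v].
  by rewrite /free !span_cons span_nil addv0.
apply: (iffP (@freeP _ _ 2 [tuple u; v])) => [H x y|H k].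
  move=> E; have /= := H (fun i : 'I_2 => nth 0 [:: x; y] i).
  rewrite !big_ord_recl big_ord0 /= addr0 => /(_ E) Hk.
  by split; [have := Hk ord0|have := Hk (lift ord0 ord0)].
rewrite !big_ord_recl big_ord0 /= addr0 => /H [k0 k1].
move=> i; case: (unliftP ord0 i) => [j ->|-> //].
by rewrite (ord1 j).
Qed.

(** A common nonzero vector a u + b v = c x + d y is the same thing as a
nontrivial linear relation between the four rows, each pair being independent.
*)
Lemma span2_capN0 u v x y :
  (\dim (<[u]> + <[v]>) == 2)%VS -> (\dim (<[x]> + <[y]>) == 2)%VS ->
  ((<[u]> + <[v]>) :&: (<[x]> + <[y]>) != 0)%VS = (\det (quad u v x y) == 0).
Proof.
move=> /dim_span2 uv /dim_span2 xy; apply/idP/det0P.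
  move=> cap0; set W := (_ :&: _)%VS in cap0.
  have := memv_pick W; rewrite memv_cap.
  case/andP=> /mem_span2[a [b E1]] /mem_span2[c [d E2]].
  exists (row4 a b (- c) (- d)).
    apply: contra_neq cap0 => r0; apply/eqP; rewrite -vpick0 E1.
    have := congr1 (fun r : 'rV_4 => r 0 (o4 0)) r0; rewrite !mxE /= => ->.
    have := congr1 (fun r : 'rV_4 => r 0 (o4 1)) r0; rewrite !mxE /= => ->.
    by rewrite !scale0r addr0.
  by rewrite mul_quad !mxE /= -E1 E2 !scaleNr addrACA !subrr addr0.
case=> r r0; rewrite mul_quad => /eqP; rewrite addr_eq0 => /eqP E.
apply: contraNneq r0 => cap0.
have : r 0 (o4 0) *: u + r 0 (o4 1) *: v
    \in ((<[u]> + <[v]>) :&: (<[x]> + <[y]>))%VS.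
  rewrite memv_cap; apply/andP; split; apply/mem_span2.
    by exists (r 0 (o4 0)), (r 0 (o4 1)).
  exists (- r 0 (o4 2)), (- r 0 (o4 3)).
  by rewrite E opprD !scaleNr.
rewrite cap0 memv0 => /eqP E0.
have [r0 r1] := uv _ _ E0.
have [r2 r3] : r 0 (o4 2) = 0 /\ r 0 (o4 3) = 0.
  by apply: xy; apply: oppr_inj; rewrite -E E0 oppr0.
apply/eqP/rowP => -[[|[|[|[|//]]]] i]; rewrite mxE;
  [rewrite -r0|rewrite -r1|rewrite -r2|rewrite -r3];
  by congr (r _ _); apply/val_inj.
Qed.

Lemma det_quad_dim u v x y : \det (quad u v x y) != 0 ->
  (\dim (<[u]> + <[v]>) == 2)%VS /\ (\dim (<[x]> + <[y]>) == 2)%VS.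
Proof.
move=> d0.
have indep a b c d :
    a *: u + b *: v + (c *: x + d *: y) = 0 -> row4 a b c d = 0.
  move=> E; apply/eqP; apply: contraR d0 => r0; apply/det0P.
  by exists (row4 a b c d) => //; rewrite mul_quad !mxE.
have E (a b c d : F) : row4 a b c d = 0 -> [/\ a = 0, b = 0, c = 0 & d = 0].
  move=> /rowP r0; split; [have := r0 (o4 0)|have := r0 (o4 1)
    |have := r0 (o4 2)|have := r0 (o4 3)]; by rewrite !mxE.
split; apply/dim_span2 => a b E0.
  by have [] : [/\ a = 0, b = 0, (0 : F) = 0 & (0 : F) = 0]
    by apply/E/indep; rewrite E0 !scale0r !addr0.
by have [] : [/\ (0 : F) = 0, (0 : F) = 0, a = 0 & b = 0]
  by apply/E/indep; rewrite E0 !scale0r !addr0.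
Qed.

Lemma quad_mul (a b c d : 'rV[F]_4) (G : 'M_4) :
  quad (a *m G) (b *m G) (c *m G) (d *m G) = quad a b c d *m G.
Proof.
apply/row_matrixP => i; rewrite row_mul !rowK.
by case: i => -[|[|[|[|]]]].
Qed.

Lemma piercesE (l l' : line F) u v x y :
  line_space l = (<[u]> + <[v]>)%VS -> line_space l' = (<[x]> + <[y]>)%VS ->
  pierces l l' = (\det (quad u v x y) == 0).
Proof.
by move=> E E'; rewrite /pierces E E' span2_capN0 // -?E -?E'; exact: line_dim.
Qed.

Lemma join_piercesE (P Q : point F) (l : line F) u v x y :
  P != Q -> point_space P = <[u]>%VS -> point_space Q = <[v]>%VS ->
  line_space l = (<[x]> + <[y]>)%VS ->
  join_pierces P Q l <-> \det (quad u v x y) = 0.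
Proof.
move=> PQ EP EQ El.
have Ej (H : P != Q) : line_space (line_through H) = (<[u]> + <[v]>)%VS.
  by rewrite /= EP EQ.
split=> [[H]|d0]; first by rewrite (piercesE (Ej H) El) => /eqP.
by exists PQ; rewrite (piercesE (Ej PQ) El); apply/eqP.
Qed.

Lemma wedge_comb u v (a b c d : F) :
  wedge (a *: u + b *: v) (c *: u + d *: v) = (a * d - b * c) *: wedge u v.
Proof. by apply/matrixP=> i j; rewrite !(wedgeE, mxE); ring. Qed.

Lemma span2_eq (l : line F) a b : a \in line_space l -> b \in line_space l ->
  (\dim (<[a]> + <[b]>) == 2)%VS -> line_space l = (<[a]> + <[b]>)%VS.
Proof.
move=> al bl /eqP dab; apply/esym/eqP.
rewrite eqEdim dab (eqP (line_dim l)) andbT.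
by rewrite subv_add -!memvE al.
Qed.

(** Two bases of a line have proportional wedges, and the factor, which is the
determinant of the change of basis, can be absorbed in the first vector.  Hence
all homogeneous Pluecker coordinates of a line, whatever their scaling, are
wedges of vectors on the directions of a given basis. *)
Lemma adapt_wedge (l : line F) u v a b :
  line_space l = (<[u]> + <[v]>)%VS -> line_space l = (<[a]> + <[b]>)%VS ->
  exists2 c : F, c != 0 & wedge (c *: a) b = wedge u v.
Proof.
move=> Euv Eab.
have /dim_span2 uv : (\dim (<[u]> + <[v]>) == 2)%VS.
  by rewrite -Euv; exact: line_dim.
have /mem_span2[p [q Eu]] : u \in (<[a]> + <[b]>)%VS.
  rewrite -Eab Euv; apply/mem_span2.
  by exists 1, 0; rewrite scale1r scale0r addr0.
have /mem_span2[r [s Ev]] : v \in (<[a]> + <[b]>)%VS.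
  rewrite -Eab Euv; apply/mem_span2.
  by exists 0, 1; rewrite scale1r scale0r add0r.
exists (p * s - q * r).
  (* If c = 0, then s u - q v = c a and r u - p v = - c b are both zero. *)
  apply/eqP => c0.
  have [s0 _] : s = 0 /\ - q = 0.
    apply: uv; transitivity ((p * s - q * r) *: a);
      last by rewrite c0 scale0r.
    by rewrite Eu Ev; apply/rowP => i; rewrite !mxE; ring.
  have [r0 _] : r = 0 /\ - p = 0.
    apply: uv; transitivity ((q * r - p * s) *: b);
      last by rewrite -opprB c0 oppr0 scale0r.
    by rewrite Eu Ev; apply/rowP => i; rewrite !mxE; ring.
  have [_ /eqP] : (0 : F) = 0 /\ (1 : F) = 0.
    by apply: uv; rewrite Ev s0 r0 !scale0r addr0 scaler0 addr0.
  by rewrite oner_eq0.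
rewrite Eu Ev wedge_comb; apply/matrixP=> i j; rewrite !(wedgeE, mxE).
ring.
Qed.

(** The vectors a and b span the intersections of m with l and l'; they are
independent because l and l' are skew. *)
Lemma transversal_coords (l l' m : line F) u v x y z w :
  line_space l = (<[u]> + <[v]>)%VS -> line_space l' = (<[x]> + <[y]>)%VS ->
  line_space m = (<[z]> + <[w]>)%VS -> ~~ pierces l l' ->
  pierces m l && pierces m l' ->
  exists n : 'rV[F]_4,
    let a := n 0 (o4 0) *: u + n 0 (o4 1) *: v in
    let b := n 0 (o4 2) *: x + n 0 (o4 3) *: y in
    line_space m = (<[a]> + <[b]>)%VS /\ wedge z w = wedge a b.
Proof.
move=> El El' Em skew /andP[ml ml'].
have capv : (l :&: l' = 0)%VS by apply/eqP; move: skew; rewrite negbK.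
set a := vpick (m :&: l)%VS; set b := vpick (m :&: l')%VS.
have a0 : a != 0 by rewrite vpick0.
have b0 : b != 0 by rewrite vpick0.
have := memv_pick (m :&: l)%VS; rewrite -/a memv_cap => /andP[am al].
have := memv_pick (m :&: l')%VS; rewrite -/b memv_cap => /andP[bm bl].
have ab : (\dim (<[a]> + <[b]>) == 2)%VS.
  apply/dim_span2 => s t E.
  have : s *: a \in (l :&: l')%VS.
    rewrite memv_cap memvZ //=; move/eqP: E; rewrite addr_eq0 => /eqP ->.
    by rewrite rpredN memvZ.
  rewrite capv memv0 scaler_eq0 (negPf a0) orbF => /eqP s0.
  split=> //; move/eqP: E; rewrite s0 scale0r add0r scaler_eq0 (negPf b0) orbF.
  by move/eqP.
have Emab := span2_eq am bm ab.
have [c c0 Ec] := adapt_wedge Em Emab.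
move: al bl; rewrite El El' => /mem_span2[n0 [n1 Ea]] /mem_span2[n2 [n3 Eb]].
exists (row4 (c * n0) (c * n1) n2 n3) => /=; rewrite !mxE /= -Eb.
have -> : (c * n0) *: u + (c * n1) *: v = c *: a.
  by rewrite Ea scalerDr !scalerA.
split=> //; apply: span2_eq => //; first exact: memvZ.
apply/dim_span2 => s t; rewrite scalerA => /(dim_span2 _ _ ab) [/eqP].
by rewrite mulf_eq0 (negPf c0) orbF => /eqP.
Qed.

End Spans.

(** * Parametrization of the space of choices *)

(** The rows of [frame] are vectors g0, g1 spanning l1 and g2, g3 spanning l2;
row k of [feet] holds the coordinates of a_k on (g0, g1), followed by those of
b_k on (g2, g3); [start] holds the coordinates of P1 on (a_3, b_3).  Indices
of the lines m_1, ..., m_5 start from 0. *)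
Record param (F : fieldType) := Param {
  frame : 'M[F]_4; feet : 'M[F]_(5, 4); start : 'rV[F]_2 }.

Section Parametrization.
Variable F : fieldType.
Implicit Types p : param F.

Definition foot1 p k :=
  feet p k (o4 0) *: row (o4 0) (frame p) +
  feet p k (o4 1) *: row (o4 1) (frame p).

Definition foot2 p k :=
  feet p k (o4 2) *: row (o4 2) (frame p) +
  feet p k (o4 3) *: row (o4 3) (frame p).

Definition start_vec p :=
  start p 0 (o2 0) *: foot1 p (o5 2) + start p 0 (o2 1) *: foot2 p (o5 2).

(** l1 and l2 come before the m_k among the seven lines of a configuration. *)
Definition m_idx (k : 'I_5) : 'I_7 := rshift 2 k.

Definition gens p (i : 'I_7) : 'rV[F]_4 * 'rV[F]_4 :=
  match split (i : 'I_(2 + 5)) with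
  | inl j => if j == ord0 then (row (o4 0) (frame p), row (o4 1) (frame p))
             else (row (o4 2) (frame p), row (o4 3) (frame p))
  | inr k => (foot1 p k, foot2 p k)
  end.

Definition coords p : 'rV[F]_(7 * (4 * 4) + 4) :=
  row_mx (mxvec (\matrix_(i < 7) mxvec (wedge (gens p i).1 (gens p i).2)))
         (start_vec p).

Definition realizes p (c : config F) :=
  (forall i : 'I_7, line_space (tnth (config_lines c) i) =
     (<[(gens p i).1]> + <[(gens p i).2]>)%VS)
  /\ point_coords (P1 c) (start_vec p).

Lemma gens0 p : gens p (o7 0) = (row (o4 0) (frame p), row (o4 1) (frame p)).
Proof.
have -> : o7 0 = lshift 5 (o2 0) by apply: val_inj.
by rewrite /gens (unsplitK (inl _)).
Qed.

Lemma gens1 p : gens p (o7 1) = (row (o4 2) (frame p), row (o4 3) (frame p)).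
Proof.
have -> : o7 1 = lshift 5 (o2 1) by apply: val_inj.
by rewrite /gens (unsplitK (inl _)).
Qed.

Lemma gensT p k : gens p (m_idx k) = (foot1 p k, foot2 p k).
Proof. by rewrite /gens /m_idx (unsplitK (inr k)). Qed.

Lemma config_line_ind (P : 'I_7 -> Prop) :
  P (o7 0) -> P (o7 1) -> (forall k, P (m_idx k)) -> forall i, P i.
Proof.
move=> P0 P1' PT i; case: (splitP (i : 'I_(2 + 5))) => [j|k] Ei; last first.
  by have -> : i = m_idx k by apply: val_inj.
case: j Ei => -[|[|//]] ? /= Ei; first
  by have -> : i = o7 0 by apply: val_inj.
by have -> : i = o7 1 by apply: val_inj.
Qed.

Lemma transversal_pierces (c : config F) k
    (m := tnth (config_lines c) (m_idx k)) :
  pierces m (l1 c) && pierces m (l2 c).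
Proof.
by rewrite /m {m}; case: k => -[|[|[|[|[|//]]]]] ?; [exact: m1_pierces|
 exact: m2_pierces|exact: m3_pierces|exact: m4_pierces|exact: m5_pierces].
Qed.

Lemma realizes_coords p c : realizes p c -> config_coords c (coords p).
Proof.
case=> El EP; split=> [i|]; last by rewrite row_mxKr.
rewrite row_mxKl mxvecK rowK mxvecK.
by exists (gens p i).1, (gens p i).2.
Qed.

(** Surjectivity of the parametrization: given spanning pairs of l1 and l2 and
the homogeneous coordinates of the other data, the frame is made of these pairs
and the scaling of each a_k is adjusted by [transversal_coords]. *)
Lemma config_coords_param (c : config F) z :
  config_coords c z -> exists2 p, realizes p c & z = coords p.
Proof.
case=> Hl HP.
have [g0 [g1 [E0 w0]]] := Hl (o7 0).
have [g2 [g3 [E1 w1]]] := Hl (o7 1).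
pose fits k (n : 'rV[F]_4) :=
  let a := n 0 (o4 0) *: g0 + n 0 (o4 1) *: g1 in
  let b := n 0 (o4 2) *: g2 + n 0 (o4 3) *: g3 in
  line_space (tnth (config_lines c) (m_idx k)) = (<[a]> + <[b]>)%VS
  /\ vec_mx (row (m_idx k) (vec_mx (lsubmx z))) = wedge a b.
have [n Hn] : exists n : 'I_5 -> 'rV[F]_4, forall k, fits k (n k).
  apply: fin_all_exists => k; have [u [v [Em Ew]]] := Hl (m_idx k).
  have [n Hn] := transversal_coords E0 E1 Em (skew_l1_l2 c)
                   (transversal_pierces c k).
  by exists n; rewrite /fits Ew.
pose G := quad g0 g1 g2 g3; pose N := \matrix_k n k.
pose p0 := Param G N 0.
have f1 k : foot1 p0 k = n k 0 (o4 0) *: g0 + n k 0 (o4 1) *: g1.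
  by rewrite /foot1 !rowK !mxE.
have f2 k : foot2 p0 k = n k 0 (o4 2) *: g2 + n k 0 (o4 3) *: g3.
  by rewrite /foot2 !rowK !mxE.
have /mem_span2[s [t Est]] :
    rsubmx z \in (<[foot1 p0 (o5 2)]> + <[foot2 p0 (o5 2)]>)%VS.
  rewrite f1 f2; have [<- _] := Hn (o5 2).
  by rewrite memvE -HP; exact: P1_on_m3.
pose p := Param G N (\row_j nth 0 [:: s; t] j).
have start_p : start_vec p = rsubmx z by rewrite Est /start_vec !mxE.
exists p.
  split; last by rewrite start_p.
  apply: config_line_ind => [||k]; rewrite ?gens0 ?gens1 ?gensT /= ?rowK //.
  by rewrite [foot1 _ _]f1 [foot2 _ _]f2; have [] := Hn k.
rewrite -[z in LHS]hsubmxK /coords start_p; congr row_mx.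
rewrite -[LHS]vec_mxK; congr mxvec; apply/row_matrixP.
apply: config_line_ind => [||k]; rewrite rowK -[LHS]vec_mxK; congr mxvec.
- by rewrite gens0 /= !rowK; exact: w0.
- by rewrite gens1 /= !rowK; exact: w1.
- by rewrite gensT [foot1 _ _]f1 [foot2 _ _]f2; have [] := Hn k.
Qed.
End Parametrization.

(** * The open set of configurations with pairwise skew m_k *)

Section SkewLocus.
Variable F : fieldType.
Implicit Types (p : param F) (i j : 'I_7).

Definition var i (r s : 'I_4) : 'I_(7 * (4 * 4) + 4) :=
  lshift 4 (mxvec_index i (mxvec_index r s)).

Definition line_det p i j :=
  \det (quad (gens p i).1 (gens p i).2 (gens p j).1 (gens p j).2).

Definition klein_poly i j : {mpoly F[7 * (4 * 4) + 4]} :=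
  klein (fun r s => 'X_(var i r s)) (fun r s => 'X_(var j r s)).

Lemma coords_var p i r s :
  coords p 0 (var i r s) = wedge (gens p i).1 (gens p i).2 r s.
Proof. by rewrite row_mxEl mxvecE mxE mxvecE. Qed.

Lemma klein_polyE p i j :
  (klein_poly i j).@[fun k => coords p 0 k] = line_det p i j.
Proof.
rewrite /line_det det_quad /klein_poly /klein.
rewrite !(rmorphB, rmorphD, rmorphM) /= !mevalXU.
by rewrite !coords_var.
Qed.

Definition generic p :=
  line_det p (o7 0) (o7 1) != 0 /\
  forall k k', k' != k -> line_det p (m_idx k) (m_idx k') != 0.

(** Skewness of l1 and l2 is imposed as well: at the coordinates of a parameter
it expresses that the frame is a basis, which an arbitrary parameter on a
segment need not satisfy. *)
Definition skew_poly : {mpoly F[7 * (4 * 4) + 4]} :=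
  klein_poly (o7 0) (o7 1) *
  \prod_(k < 5) \prod_(k' < 5 | k' != k) klein_poly (m_idx k) (m_idx k').

Lemma skew_polyE p :
  reflect (generic p) (skew_poly.@[fun k => coords p 0 k] != 0).
Proof.
rewrite /skew_poly mevalM klein_polyE mulf_eq0 negb_or.
have -> : (\prod_(k < 5) \prod_(k' < 5 | k' != k)
      klein_poly (m_idx k) (m_idx k')).@[fun k => coords p 0 k] =
    \prod_(k < 5) \prod_(k' < 5 | k' != k) line_det p (m_idx k) (m_idx k').
  rewrite rmorph_prod; apply: eq_bigr => k _ /=.
  by rewrite rmorph_prod; apply: eq_bigr => k' _; exact: klein_polyE.
apply: (iffP andP) => -[d0 H]; split=> //.
  move=> k k' kk'; move/prodf_neq0: H => /(_ k isT).
  by move/prodf_neq0; apply.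
by apply/prodf_neq0 => k _; apply/prodf_neq0 => k' kk'; exact: H.
Qed.

End SkewLocus.

(** * Closing of the hexagon *)

Section Closing.
Variable F : fieldType.
Implicit Types p : param F.

Definition bracket1 p k k' :=
  feet p k (o4 0) * feet p k' (o4 1) - feet p k (o4 1) * feet p k' (o4 0).

Definition bracket2 p k k' :=
  feet p k (o4 2) * feet p k' (o4 3) - feet p k (o4 3) * feet p k' (o4 2).

Definition pt_vec p k (s t : F) := s *: foot1 p k + t *: foot2 p k.

Lemma quad_rows (G : 'M[F]_4) :
  quad (row (o4 0) G) (row (o4 1) G) (row (o4 2) G) (row (o4 3) G) = G.
Proof.
apply/row_matrixP => i; rewrite rowK.
by case: i => -[|[|[|[|//]]]] ? /=; congr row; apply: val_inj.
Qed.

Lemma scale_pt_vec p k d s t :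
  d *: pt_vec p k s t = pt_vec p k (d * s) (d * t).
Proof.
by rewrite /pt_vec -[in RHS]scalerA -[in RHS]scalerA -[in RHS]scalerDr.
Qed.

(** Written this way, the determinants below split into that of the frame and
one of explicit coordinate rows. *)
Lemma pt_vec_frame p k s t : pt_vec p k s t =
  row4 (s * feet p k (o4 0)) (s * feet p k (o4 1))
       (t * feet p k (o4 2)) (t * feet p k (o4 3)) *m frame p.
Proof.
rewrite -[in RHS](quad_rows (frame p)) mul_quad !mxE /=.
by rewrite /pt_vec /foot1 /foot2 !scalerDr !scalerA.
Qed.

Lemma foot1E p k : foot1 p k = pt_vec p k 1 0.
Proof. by rewrite /pt_vec scale1r scale0r addr0. Qed.

Lemma foot2E p k : foot2 p k = pt_vec p k 0 1.
Proof. by rewrite /pt_vec scale1r scale0r add0r. Qed.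

(** In frame coordinates the rows are (s a_i, t b_i), (x a_j, y b_j), (a_k, 0)
and (0, b_k).  The Laplace expansion along the column pairs of l1 and l2 keeps
only the terms where one of the first two rows is used in l1 and the other in
l2. *)
Lemma det_join p (i j k : 'I_5) (s t x y : F) :
  \det (quad (pt_vec p i s t) (pt_vec p j x y) (foot1 p k) (foot2 p k)) =
  (t * x * bracket1 p j k * bracket2 p i k
   - s * y * bracket1 p i k * bracket2 p j k) * \det (frame p).
Proof.
rewrite foot1E foot2E !pt_vec_frame quad_mul det_mulmx; congr (_ * _).
rewrite det_quad /klein !wedgeE !mxE /= /bracket1 /bracket2; ring.
Qed.

Lemma line_detT p (i k : 'I_5) : line_det p (m_idx i) (m_idx k) =
  - (bracket1 p i k * bracket2 p i k) * \det (frame p).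
Proof.
rewrite /line_det !gensT /= {1}[foot1 p i]foot1E {1}[foot2 p i]foot2E.
by rewrite det_join; congr (_ * _); ring.
Qed.

Lemma generic_neq0 p : generic p ->
  (forall k k', k' != k -> bracket1 p k k' != 0 /\ bracket2 p k k' != 0) /\
  \det (frame p) != 0.
Proof.
case=> _ H; split.
  move=> k k' /H; rewrite line_detT !mulf_eq0 oppr_eq0 !mulf_eq0 !negb_or.
  by case/andP=> /andP[].
by have := H (o5 0) (o5 1) isT; rewrite line_detT !mulf_eq0 negb_or => /andP[].
Qed.

Lemma pt_vec_eq0 p k s t : generic p -> pt_vec p k s t = 0 -> s = 0 /\ t = 0.
Proof.
move=> gp; have [k' kk'] : exists k', k' != k.
  case: (eqVneq k (o5 0)) => [->|]; first by exists (o5 1).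
  by rewrite eq_sym; exists (o5 0).
have := (proj2 gp) k k' kk'; rewrite /line_det !gensT.
case/det_quad_dim => /dim_span2 H _.
exact: H.
Qed.

Lemma point_neq0 (P : point F) (u : 'rV[F]_4) :
  point_space P = <[u]>%VS -> u != 0.
Proof.
by move=> E; have := point_dim P; rewrite E dim_vline; case: (u != 0).
Qed.

Section Realized.
Variables (p : param F) (c : config F).
Hypotheses (gp : generic p) (pc : realizes p c).
Let m k := tnth (config_lines c) (m_idx k).

Lemma m_space k : line_space (m k) = (<[foot1 p k]> + <[foot2 p k]>)%VS.
Proof. by case: pc => /(_ (m_idx k)); rewrite gensT. Qed.

(** This is where the skewness of m_3, m_4, m_5 is used: successive vertices of
the hexagon lie on two of them, so that their join exists. *)
Lemma points_neq (i j : 'I_5) (P Q : point F) : j != i ->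
  on_line P (m i) -> on_line Q (m j) -> P != Q.
Proof.
move=> ij Pi Qj; apply/eqP => E; rewrite -{Q}E in Qj.
have : ~~ pierces (m i) (m j).
  rewrite (piercesE (m_space i) (m_space j)).
  by have := proj2 gp i j ij; rewrite /line_det !gensT.
rewrite negbK => /eqP cap0.
have : (P <= m i :&: m j)%VS by rewrite subv_cap; apply/andP.
by rewrite cap0 subv0 -dimv_eq0 (eqP (point_dim P)).
Qed.

Lemma pt_on_line k s t (P : point F) :
  point_space P = <[pt_vec p k s t]>%VS -> on_line P (m k).
Proof.
by move=> E; rewrite /on_line E m_space -memvE; apply/mem_span2; exists s, t.
Qed.

(** The incidence relation is diagonal in (s, t), (x, y), so that it determines
(x : y) from (s : t). *)
Lemma join_ptE (i j k : 'I_5) (P Q : point F) s t x y : j != i ->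
  point_space P = <[pt_vec p i s t]>%VS ->
  point_space Q = <[pt_vec p j x y]>%VS ->
  join_pierces P Q (m k) <->
  t * x * bracket1 p j k * bracket2 p i k =
  s * y * bracket1 p i k * bracket2 p j k.
Proof.
move=> ij EP EQ.
have PQ := points_neq ij (pt_on_line EP) (pt_on_line EQ).
rewrite (join_piercesE PQ EP EQ (m_space k)).
rewrite det_join; split=> [/eqP|->]; last by rewrite subrr mul0r.
by rewrite mulf_eq0 (negPf (generic_neq0 gp).2) orbF subr_eq0 => /eqP.
Qed.

(** One side of the hexagon.  All brackets being nonzero, the relation of
[join_ptE] has a unique solution (x : y), which covers both the existence of
the next vertex and its independence of how it is found. *)
Lemma find_step (i j k : 'I_5) (K : point F -> Prop) (P : point F) s t :
  j != i -> k != i -> k != j ->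
  point_space P = <[pt_vec p i s t]>%VS ->
  (forall Q, point_space Q =
    <[pt_vec p j (s * (bracket1 p i k * bracket2 p j k))
                 (t * (bracket1 p j k * bracket2 p i k))]>%VS -> K Q) ->
  find_point (fun Q => on_line Q (m j) /\ join_pierces P Q (m k)) K.
Proof.
move=> ij ik jk EP HK.
have [nz dG] := generic_neq0 gp.
have [a0 b0] := nz i k ik; have [a0' b0'] := nz j k jk.
set x := s * _ in HK; set y := t * _ in HK.
have nst := point_neq0 EP.
have xy0 : pt_vec p j x y != 0.
  apply: contra_neq nst => /(pt_vec_eq0 gp)[/eqP].
  rewrite /x mulf_eq0 [_ * _ == 0]mulf_eq0 (negPf a0) (negPf b0') !orbF.
  move=> /eqP -> /eqP.
  rewrite /y mulf_eq0 [_ * _ == 0]mulf_eq0 (negPf a0') (negPf b0) !orbF.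
  by move=> /eqP ->; rewrite /pt_vec !scale0r addr0.
have dQ : (\dim <[pt_vec p j x y]> == 1)%VS by rewrite dim_vline xy0.
split.
  exists (Point dQ); split; first exact: (@pt_on_line j x y).
  apply/(join_ptE k ij EP (erefl : point_space (Point dQ) = _)).
  by rewrite /x /y; ring.
move=> Q [Qj PQk]; apply: HK.
have EQ : point_space Q = <[vpick Q]>%VS.
  have v0 : vpick Q != 0 by rewrite vpick0 -dimv_eq0 (eqP (point_dim Q)).
  apply/esym/eqP.
  by rewrite eqEdim -memvE memv_pick dim_vline v0 (eqP (point_dim Q)).
have /mem_span2[x' [y' Exy]] : vpick Q \in (<[foot1 p j]> + <[foot2 p j]>)%VS.
  by rewrite -m_space; apply: (subvP Qj); exact: memv_pick.
rewrite Exy in EQ; move/(join_ptE k ij EP EQ): PQk => R.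
have vn := point_neq0 EQ.
(* (x', y') solves the same linear equation as (x, y), hence is proportional
   to it. *)
have cross : y * x' = x * y'.
  transitivity (t * x' * bracket1 p j k * bracket2 p i k); last rewrite R /x.
    by rewrite /y; ring.
  by ring.
have [d Ed] : exists d, pt_vec p j x y = d *: pt_vec p j x' y'.
  have [x'0|x'0] := eqVneq x' 0.
    have y'0 : y' != 0.
      by apply: contra_neq vn => y'0; rewrite x'0 y'0 !scale0r addr0.
    have x0 : x = 0.
      apply/eqP; move/eqP: cross.
      by rewrite x'0 mulr0 eq_sym mulf_eq0 (negPf y'0) orbF.
    by exists (y / y'); rewrite scale_pt_vec divfK // x'0 x0 mulr0.
  by exists (x / x'); rewrite scale_pt_vec divfK // mulrAC -cross mulfK.
apply/eqP; rewrite EQ eq_sym eqEdim !dim_vline xy0 leq_b1 andbT -memvE Ed.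
by apply: memvZ; exact: memv_line.
Qed.

(** The six multipliers f_31/f_41, f_42/f_52, f_51/f_31, f_32/f_42, f_41/f_51
and f_52/f_32 cancel; cleared of denominators, this is the last polynomial
identity between the brackets. *)
Lemma generic_closes_up : closes_up c.
Proof.
pose s := start p 0 (o2 0); pose t := start p 0 (o2 1).
have EP1 : point_space (P1 c) = <[pt_vec p (o5 2) s t]>%VS.
  by case: pc.
apply: (find_step (j := o5 3) (k := o5 0) _ _ _ EP1) => // P2 EP2.
apply: (find_step (j := o5 4) (k := o5 1) _ _ _ EP2) => // P3 EP3.
apply: (find_step (j := o5 2) (k := o5 0) _ _ _ EP3) => // P4 EP4.
apply: (find_step (j := o5 3) (k := o5 1) _ _ _ EP4) => // P5 EP5.
apply: (find_step (j := o5 4) (k := o5 0) _ _ _ EP5) => // P6 EP6.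
by apply/(join_ptE (o5 1) _ EP6 EP1) => //; ring.
Qed.

End Realized.

(** Off the zero locus of [skew_poly] the vectors given by a parameter are as
independent as required, so the parametrization is defined there. *)
Lemma generic_realizable p :
  generic p -> start p != 0 -> exists c, realizes p c.
Proof.
move=> gp s0; have [d01 dT] := gp.
have dim01 :
    \dim (<[row (o4 0) (frame p)]> + <[row (o4 1) (frame p)]>)%VS == 2 /\
    \dim (<[row (o4 2) (frame p)]> + <[row (o4 3) (frame p)]>)%VS == 2.
  by apply: det_quad_dim; move: d01; rewrite /line_det gens0 gens1.
have dim_m k : \dim (<[foot1 p k]> + <[foot2 p k]>)%VS == 2.
  by apply/dim_span2 => s t; exact: pt_vec_eq0.
have dimP : \dim <[start_vec p]>%VS == 1.
  rewrite dim_vline; have -> // : start_vec p != 0.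
  apply: contra_neq s0 => /(pt_vec_eq0 gp)[s0 t0].
  apply/rowP => -[[|[|//]]] i; rewrite mxE.
    by rewrite -s0; congr (start p _ _); apply: val_inj.
  by rewrite -t0; congr (start p _ _); apply: val_inj.
pose L1 := Line dim01.1; pose L2 := Line dim01.2; pose m k := Line (dim_m k).
have skew : ~~ pierces L1 L2.
  rewrite (piercesE (erefl : line_space L1 = _) (erefl : line_space L2 = _)).
  by move: d01; rewrite /line_det gens0 gens1.
have mL k : pierces (m k) L1 && pierces (m k) L2.
  have pierce_of u (l l' : line F) :
      u != 0 -> u \in line_space l -> u \in line_space l' -> pierces l l'.
    move=> u0 ul ul'; apply: contraNneq u0 => cap0.
    by rewrite -memv0 -cap0 memv_cap; apply/andP.
  apply/andP; split;
    [apply: (pierce_of (foot1 p k))|apply: (pierce_of (foot2 p k))].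
  - by apply/eqP; rewrite foot1E => /(pt_vec_eq0 gp)[/eqP]; rewrite oner_eq0.
  - by rewrite foot1E; apply/mem_span2; exists 1, 0.
  - by apply/mem_span2; exists (feet p k (o4 0)), (feet p k (o4 1)).
  - by apply/eqP; rewrite foot2E => /(pt_vec_eq0 gp)[_ /eqP]; rewrite oner_eq0.
  - by rewrite foot2E; apply/mem_span2; exists 0, 1.
  - by apply/mem_span2; exists (feet p k (o4 2)), (feet p k (o4 3)).
have Pm : on_line (Point dimP) (m (o5 2)).
  rewrite /on_line -memvE; apply/mem_span2.
  by exists (start p 0 (o2 0)), (start p 0 (o2 1)).
exists (Config skew (mL (o5 0)) (mL (o5 1)) (mL (o5 2)) (mL (o5 3)) (mL (o5 4))
          Pm).
split=> //; apply: config_line_ind => [||k]; rewrite ?gens0 ?gens1 ?gensT //.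
by case: k => -[|[|[|[|[|//]]]]] i /=;
 congr (<[foot1 p _]> + <[foot2 p _]>)%VS; apply: val_inj.
Qed.

End Closing.

(** * Polynomial functions on a segment of parameters *)

Section Segment.
Variable F : fieldType.

Definition polyfun (g : F -> F) := exists q : {poly F}, forall t, g t = q.[t].

Lemma polyfun_cst a : polyfun (fun=> a).
Proof. by exists a%:P => t; rewrite hornerC. Qed.

Lemma polyfun_id : polyfun id.
Proof. by exists 'X => t; rewrite hornerX. Qed.

Lemma polyfunD g h : polyfun g -> polyfun h -> polyfun (fun t => g t + h t).
Proof. by move=> [p Ep] [q Eq]; exists (p + q) => t; rewrite hornerD Ep Eq. Qed.

Lemma polyfunM g h : polyfun g -> polyfun h -> polyfun (fun t => g t * h t).
Proof. by move=> [p Ep] [q Eq]; exists (p * q) => t; rewrite hornerM Ep Eq. Qed.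

Lemma polyfunB g h : polyfun g -> polyfun h -> polyfun (fun t => g t - h t).
Proof.
move=> [p Ep] [q Eq].
by exists (p - q) => t; rewrite hornerD hornerN Ep Eq.
Qed.

Lemma polyfun_meval n (f : {mpoly F[n]}) (z : F -> 'I_n -> F) :
  (forall k, polyfun (fun t => z t k)) -> polyfun (fun t => f.@[z t]).
Proof.
move=> H; have [q Eq] := fin_all_exists H.
exists (\sum_(m <- msupp f) f@_m *: \prod_i q i ^+ m i) => t.
rewrite mevalE horner_sum; apply: eq_bigr => m _.
rewrite hornerZ horner_prod; congr (_ * _); apply: eq_bigr => i _.
by rewrite horner_exp Eq.
Qed.

(** Only the lines move: the coordinates of P1 on (a_3, b_3) are kept, so that
P1 remains a point wherever a_3 and b_3 are independent. *)
Definition segment (p q : param F) t := Param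
  (frame p + t *: (frame q - frame p)) (feet p + t *: (feet q - feet p))
  (start p).

Lemma polyfun_coords p q k :
  polyfun (fun t => coords (segment p q t) 0 k).
Proof.
have affine a b : polyfun (fun t => a + t * (b - a)).
  by apply: polyfunD; [|apply: polyfunM];
    (exact: polyfun_cst || exact: polyfun_id).
have Hframe i j : polyfun (fun t => row i (frame (segment p q t)) 0 j).
  have [r Er] := affine (frame p i j) (frame q i j).
  by exists r => t; rewrite -Er !mxE.
have Hfeet i j : polyfun (fun t => feet (segment p q t) i j).
  have [r Er] := affine (feet p i j) (feet q i j).
  by exists r => t; rewrite -Er !mxE.
have comb (a b : F -> F) (u v : F -> 'rV[F]_4) j : polyfun a -> polyfun b ->
    polyfun (fun t => u t 0 j) -> polyfun (fun t => v t 0 j) ->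
    polyfun (fun t => (a t *: u t + b t *: v t) 0 j).
  move=> Ha Hb Hu Hv.
  have [r Er] := polyfunD (polyfunM Ha Hu) (polyfunM Hb Hv).
  by exists r => t; rewrite -Er !mxE.
have Hfoot1 i j : polyfun (fun t => foot1 (segment p q t) i 0 j).
  by apply: comb.
have Hfoot2 i j : polyfun (fun t => foot2 (segment p q t) i 0 j).
  by apply: comb.
have Hgens i j : polyfun (fun t => (gens (segment p q t) i).1 0 j) /\
    polyfun (fun t => (gens (segment p q t) i).2 0 j).
  rewrite /gens; case: (split _) => [k'|k'] /=; last by split.
  by case: (k' == ord0); split; exact: Hframe.
rewrite -[k]splitK; case: (split k) => [l|j] /=; last first.
  have [d Ed] : polyfun (fun t => start_vec (segment p q t) 0 j)
    by apply: comb => //; exact: polyfun_cst.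
  by exists d => t; rewrite -Ed row_mxEr.
case/mxvec_indexP: l => i l; case/mxvec_indexP: l => r s.
have [r1 r2] := Hgens i r; have [s1 s2] := Hgens i s.
have [d Ed] := polyfunB (polyfunM r1 s2) (polyfunM r2 s1).
by exists d => t; rewrite -Ed (coords_var _ i) wedgeE.
Qed.

Lemma segment0 p q : segment p q 0 = p.
Proof. by case: p => *; rewrite /segment /= !scale0r !addr0. Qed.

Lemma frame_feet_segment1 p q :
  frame (segment p q 1) = frame q /\ feet (segment p q 1) = feet q.
Proof. by rewrite /= !scale1r ![_ + (_ - _)]addrC !subrK. Qed.

Lemma generic_frame_feet (p q : param F) :
  frame p = frame q -> feet p = feet q -> generic p -> generic q.
Proof.
case: p q => G N s [G' N' s'] /= <- <-.
by rewrite /generic /line_det /gens; case.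
Qed.

Lemma not_zero_locus S (c : config F) : ~ zero_locus S c ->
  exists f z, [/\ S f, config_coords c z & f.@[fun k => z 0 k] != 0].
Proof.
move=> H; apply: contrapT => H'; apply: H => f Sf z cz; apply/eqP.
by apply: contraT => fz; case: H'; exists f, z.
Qed.

End Segment.

(** * Density *)

Section Genericity.
Variable F : numFieldType.

(** The images of the natural numbers are more numerous than the roots of q r.
*)
Lemma common_nonroot (q r : {poly F}) :
  q != 0 -> r != 0 -> exists t, q.[t] != 0 /\ r.[t] != 0.
Proof.
move=> q0 r0; have qr0 : q * r != 0 by rewrite mulf_neq0.
pose s : seq F := [seq k%:R | k <- iota 0 (size (q * r)%R)].
have [/allP H|] := boolP (all (root (q * r)) s).
  have us : uniq s.
    by rewrite map_inj_uniq ?iota_uniq // => a b /eqP; rewrite eqr_nat => /eqP.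
  have := max_poly_roots qr0 (introT allP H) us.
  by rewrite size_map size_iota ltnn.
case/allPn => t _; rewrite /root hornerM mulf_eq0 negb_or => /andP[? ?].
by exists t.
Qed.

(** Over the standard frame, a_k = (1, k) and b_k = (1, k), so that all the
brackets of indices k and k' are equal to k' - k, nonzero in characteristic 0.
*)
Definition example : param F :=
  Param 1%:M (\matrix_(k, j) if odd j then k%:R else 1) (\row_j 1).

Lemma example_generic : generic example.
Proof.
split; first by rewrite /line_det gens0 gens1 quad_rows det1 oner_eq0.
move=> k k' kk'; rewrite line_detT det1 mulr1 oppr_eq0 mulf_eq0 negb_or.
rewrite /bracket1 /bracket2 !mxE /= mulr1 mul1r subr_eq0 eqr_nat.
by rewrite andbb; apply: contra kk' => /eqP E; apply/eqP/val_inj.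
Qed.

Lemma generically_closes_up : generically (@closes_up F).
Proof.
pose S (f : {mpoly F[7 * (4 * 4) + 4]}) := f = skew_poly F.
have US p (c : config F) : realizes p c -> generic p -> ~ zero_locus S c.
  move=> pc gp zc; have /skew_polyE/eqP := gp; apply.
  by apply: zc (realizes_coords pc).
exists (fun c => ~ zero_locus S c); split.
- by exists S.
- have [|c ec] := generic_realizable example_generic; last first.
    by exists c; exact: US ec example_generic.
  by apply/eqP => /rowP/(_ ord0)/eqP; rewrite !mxE oner_eq0.
- move=> V [T VT] [c0 /VT /not_zero_locus[f [z [Tf cz fz]]]].
  have [p pc0 Ez] := config_coords_param cz.
  have s0 : start p != 0.
    apply: contra_neq (point_neq0 pc0.2) => s0.
    by rewrite /start_vec s0 !mxE !scale0r addr0.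
  have [rf Ef] := polyfun_meval f (polyfun_coords p example).
  have [rg Eg] := polyfun_meval (skew_poly F) (polyfun_coords p example).
  (* The equation of V is nonzero at t = 0, and skew_poly at t = 1. *)
  have [t [ft gt]] : exists t, rf.[t] != 0 /\ rg.[t] != 0.
    apply: common_nonroot.
      apply: contra_neq fz => rf0; rewrite Ez -(segment0 p example).
      by rewrite Ef rf0 horner0.
    have : rg.[1] != 0; last by apply: contra_neq => ->; rewrite horner0.
    rewrite -Eg; apply/skew_polyE.
    have [Efr Eft] := frame_feet_segment1 p example.
    exact: generic_frame_feet (esym Efr) (esym Eft) example_generic.
  rewrite -Ef in ft; rewrite -Eg in gt.
  have gq : generic (segment p example t) by apply/skew_polyE.
  have [c pc] := generic_realizable gq s0.
  exists c; split; first exact: US pc gq.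
  apply/VT => zc; move/eqP: ft; apply.
  by apply: (zc f Tf); exact: realizes_coords.
- move=> c /not_zero_locus[f [z [-> cz fz]]].
  have [p pc Ez] := config_coords_param cz.
  by apply: generic_closes_up pc; apply/skew_polyE; rewrite -Ez.
Qed.

End Genericity.

Theorem theorem5p11 (R : realType) :
  generically (@closes_up R) /\ generically (@closes_up (complex R)).
Proof. by split; exact: generically_closes_up. Qed.
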